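(* Let $L\ge0$ be an integer and $N=4L+1$. Define $N$ vectors in $\mathbb R^N$ as follows: $$\mathbf w_n=\mathbf u_n+N^{-1/2}S(2L+2n)\,\mathbf u_{-n},\quad 0\le n\le L,$$ $$\mathbf x_n=\mathbf v_n+N^{-1/2}S(2L+2n+1)\,\mathbf v_{-n-1},\quad 0\le n\le L-1,$$ $$\mathbf y_n=-\mathbf u_{n+1}+N^{-1/2}S(2L+2n+2)\,\mathbf u_{-n-1},\quad 0\le n\le L-1,$$ $$\mathbf z_n=-\mathbf v_n+N^{-1/2}S(2L+2n+1)\,\mathbf v_{-n-1},\quad 0\le n\le L-1.$$ Then the vectors $\{\mathbf w_n\}_{0\le n\le L}$ form a basis of the eigenspace $W$, the vectors $\{\mathbf x_n\}_{0\le n\le L-1}$ form a basis of the eigenspace $X$, the vectors $\{\mathbf y_n\}_{0\le n\le L-1}$ form a basis of the eigenspace $Y$, and the vectors $\{\mathbf z_n\}_{0\le n\le L-1}$ form a basis of the eigenspace $Z$.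
   Context: For $N=4L+1$, vectors in $\mathbb C^N$ (and $\mathbb R^N$) are indexed by $I_N=\{-2L,\dots,2L\}$; the entry of $\mathbf u$ at index $k$ is written $u(k)$. The (centered) discrete Fourier transform $\mathcal F:\mathbb C^N\to\mathbb C^N$ is $$(\mathcal F\mathbf u)(j)=\frac1{\sqrt N}\sum_{k\in I_N}e^{-2\pi \mathrm i kj/N}u(k),\qquad j\in I_N.$$ $W,X,Y,Z\subset\mathbb R^N$ denote the (real) eigenspaces of $\mathcal F$ corresponding to the eigenvalues $1,-\mathrm i,-1,\mathrm i$ respectively, i.e. the real vector spaces $\{\mathbf a\in\mathbb R^N:\mathcal F\mathbf a=\lambda\mathbf a\}$ with $\lambda=1,-\mathrm i,-1,\mathrm i$. The sequence $S(k)$, $k\ge0$ (depending on $N$), is defined by $S(0)=1$ and $S(k)=\prod_{j=1}^k2\sin(\pi j/N)$ for $k\ge1$ (so $S(k)=0$ for $k\ge N$). The vectors $\mathbf u_n$ ($-L\le n\le L$) and $\mathbf v_n$ ($-L\le n\le L-1$) in $\mathbb R^N$ are, for $k\in I_N$, $$u_n(k)=S(3L+n+k)S(3L+n-k),\qquad v_n(k)=\sin(2\pi k/N)S(3L+n+k)S(3L+n-k).$$ *)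

(* Defs.v *)
From HB Require Import structures.
From mathcomp Require Import all_boot all_order all_algebra.
From mathcomp Require Import complex.
From mathcomp Require Import reals trigo.

Set Implicit Arguments.
Unset Strict Implicit.
Unset Printing Implicit Defensive.

Import Order.TTheory GRing.Theory Num.Theory.
Local Open Scope ring_scope.
Local Open Scope complex_scope.

Definition dimN (L : nat) : nat := (4 * L).+1%N.

(* The coordinate i = 0, ..., 4L of a column vector stands for the centered
   index cidx i in I_N = {-2L, ..., 2L}. *)
Definition cidx (L : nat) (i : 'I_(dimN L)) : int := (i : nat)%:Z - (2 * L)%N%:Z.

Section Vectors.
Variables (R : realType) (L : nat).
Local Notation N := (dimN L).

Definition expi (t : R) : R[i] := cos t +i* sin t.

Definition invsqrtN : R := (Num.sqrt N%:R)^-1.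

Definition dft (u : 'cV[R[i]]_N) : 'cV[R[i]]_N :=
  \col_j (invsqrtN%:C *
    \sum_k expi (- (2 * pi * (cidx k)%:~R * (cidx j)%:~R / N%:R)) * u k 0).

Definition toC (a : 'cV[R]_N) : 'cV[R[i]]_N := map_mx (real_complex R) a.

Definition real_eigenspace (lambda : R[i]) : {pred 'cV[R]_N} :=
  [pred a : 'cV[R]_N | dft (toC a) == lambda *: toC a].

Definition Sprod (k : nat) : R := \prod_(1 <= j < k.+1) (2 * sin (pi * j%:R / N%:R)).

(* Sprod at an integer argument; uvec and vvec below only evaluate it at
   nonnegative arguments when -L <= n, as |k| <= 2L. *)
Definition Sz (m : int) : R := Sprod `|m|%N.

Definition uvec (n : int) : 'cV[R]_N :=
  \col_k (Sz ((3 * L)%N%:Z + n + cidx k) * Sz ((3 * L)%N%:Z + n - cidx k)).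

Definition vvec (n : int) : 'cV[R]_N :=
  \col_k (sin (2 * pi * (cidx k)%:~R / N%:R)
          * Sz ((3 * L)%N%:Z + n + cidx k) * Sz ((3 * L)%N%:Z + n - cidx k)).

Definition wvec (n : nat) : 'cV[R]_N :=
  uvec n%:Z + (invsqrtN * Sprod (2 * L + 2 * n)%N) *: uvec (- n%:Z).

Definition xvec (n : nat) : 'cV[R]_N :=
  vvec n%:Z + (invsqrtN * Sprod (2 * L + 2 * n + 1)%N) *: vvec (- n%:Z - 1).

Definition yvec (n : nat) : 'cV[R]_N :=
  - uvec (n%:Z + 1) + (invsqrtN * Sprod (2 * L + 2 * n + 2)%N) *: uvec (- n%:Z - 1).

Definition zvec (n : nat) : 'cV[R]_N :=
  - vvec n%:Z + (invsqrtN * Sprod (2 * L + 2 * n + 1)%N) *: vvec (- n%:Z - 1).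

End Vectors.

(* basis_of for a subspace given as a predicate rather than as a {vspace vT}. *)
Definition is_basis (K : fieldType) (vT : vectType K) (E : {pred vT})
    (X : seq vT) : Prop :=
  free X /\ <<X>>%VS =i E.

(* Main.v *)
Require Import Defs.
From mathcomp Require Import all_boot all_order all_algebra.
From mathcomp Require Import complex.
From mathcomp Require Import reals trigo.
From mathcomp Require Import zify ring lra.
Local Open Scope ring_scope.

Set Implicit Arguments.
Unset Strict Implicit.
Unset Printing Implicit Defensive.
Import Order.TTheory GRing.Theory Num.Theory.

(** On real vectors the transform is [cosmx - i sinmx], a real cosine matrix
    and a real sine matrix. Hence a real vector [a] belongs to the eigenvalue
    [mu - i nu] exactly when [cosmx a = mu a] and [sinmx a = nu a]
    ([in_real_eigenspace]). The vectors u_n are even and are killed by [sinmx];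
    the vectors v_n are odd and are killed by [cosmx]. So the four eigenvalues
    separate into a parity and a sign.

    The analytic heart is that [cosmx] maps u_n to a multiple of u_(-n) and
    [sinmx] maps v_n to a multiple of v_(-n-1). Since S(k) S(N-1-k) = N,
    the entry u_n(k) with m = L - n is, up to a constant, the symmetric
    q-binomial coefficient of 2m over m + k at q = exp(2 i pi / N). Its cosine
    sum is therefore a value of Gauss's q-binomial theorem ([gauss_cos]), which
    is a product of 2m consecutive numbers 2 sin(pi l / N); by the same
    relation such a window is a product of two values of S ([Sz_window]), that
    is, an entry of u_(-n) ([cos_profile]). For v_n the factor
    sin(2 pi k / N) produces the difference of two neighbouring cosine sums
    ([sin_profile]).

    The rest is linear algebra. If T swaps a and b up to reciprocal
    factors, c b = T a and T b = a / c, then a + c b and - a + c b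
    are eigenvectors for 1 and -1: these are the vectors w, y (even) and x, z
    (odd). They are free because their supports increase strictly. They span
    because (T^2 + e T) / 2 fixes every eigenvector of sign e
    and maps each u_n and each v_n to a multiple of one of the listed
    vectors, while the u_n and v_n together generate the whole space
    ([parity_ind]). *)

(** * Free families and swapped pairs *)

(** Reading the coefficients off at the positions [pos], from the last vector
    to the first. *)
Lemma free_triangular (F : fieldType) (n p : nat) (f : 'I_p -> 'cV[F]_n)
    (pos : 'I_p -> 'I_n) :
  (forall i, f i (pos i) 0 != 0) ->
  (forall i j : 'I_p, (i < j)%N -> f i (pos j) 0 = 0) ->
  free [tuple f i | i < p].
Proof.
move=> fii fij; apply/freeP => k k0.
suff H q : forall i : 'I_p, (p <= q + i)%N -> k i = 0.
  by move=> i; apply: (H p); rewrite leq_addr.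
elim: q => [|q IH] i iq; first by have := ltn_ord i; lia.
move/colP/(_ (pos i)): k0; rewrite summxE (bigD1 i) // big1.
  rewrite nth_mktuple !mxE /= addr0 => /eqP.
  by rewrite mulf_eq0 (negPf (fii i)) orbF => /eqP.
move=> j ji; rewrite nth_mktuple !mxE.
case: (ltngtP i j) => [ij|ij|/val_inj ij]; last by rewrite ij eqxx in ji.
  by rewrite IH ?mul0r //; lia.
by rewrite fij ?mulr0.
Qed.

(** An involution up to reciprocal scalars: the first identity gives
    eigenvectors, the other two give the images of [a] and [b] under twice the
    spectral projector [(T ^ 2 + e T) / 2]. *)
Lemma eigen_pair (F : fieldType) (n : nat) (T : 'M[F]_n) (a b : 'cV[F]_n)
    (c d e : F) :
  T *m a = c *: b -> T *m b = d *: a -> c * d = 1 -> e * e = 1 ->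
  let g := e *: a + c *: b in
  [/\ T *m g = e *: g, T *m (T *m a) + e *: (T *m a) = e *: g
    & T *m (T *m b) + e *: (T *m b) = d *: g].
Proof.
move=> Ta Tb cd ee /=; rewrite mulmxDr -!scalemxAr Ta Tb -!scalemxAr Ta Tb.
rewrite !scalerDr !scalerA cd ee [d * c]mulrC cd !scale1r.
by split; rewrite addrC // [d * e]mulrC.
Qed.

Section CenteredDFT.
Variables (R : realType) (L : nat).
Local Notation N := (dimN L).
Local Notation S := (Sprod R L).
Local Notation Sz := (Sz R L).

(** * The numbers 2 sin(pi x / N) and their products *)

Definition chord (x : R) : R := 2 * sin (pi * x / N%:R).

Lemma dimN_neq0 : N%:R != 0 :> R.
Proof. by rewrite pnatr_eq0. Qed.

Lemma dimNE : N%:R = 4 * L%:R + 1 :> R.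
Proof. by rewrite /dimN; ring. Qed.

Lemma chord0 : chord 0 = 0.
Proof. by rewrite /chord mulr0 mul0r sin0 mulr0. Qed.

Lemma chordN x : chord (- x) = - chord x.
Proof. by rewrite /chord mulrN mulNr sinN mulrN. Qed.

Lemma chordDdim x : chord (N%:R + x) = - chord x.
Proof.
rewrite /chord (_ : pi * (N%:R + x) / N%:R = pi * x / N%:R + pi).
  by rewrite sinDpi mulrN.
by have := dimN_neq0; move=> ?; field.
Qed.

Lemma chord_refl x : chord (N%:R - x) = chord x.
Proof. by rewrite chordDdim chordN opprK. Qed.

Lemma chord_gt0 (k : nat) : (0 < k < N)%N -> 0 < chord k%:R.
Proof.
move=> /andP[k0 kN]; rewrite mulr_gt0 ?ltr0n //.
rewrite sin_gt0_pi // -mulrA mulr_gt0 ?pi_gt0 ?divr_gt0 ?ltr0n //=.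
by rewrite gtr_pMr ?pi_gt0 // ltr_pdivrMr ?ltr0n // mul1r ltr_nat.
Qed.

Lemma chord_neq0 (k : nat) : (0 < k < N)%N -> chord k%:R != 0.
Proof. by move=> kN; rewrite gt_eqF ?chord_gt0. Qed.

Lemma chordM x y :
  chord x * chord y =
  2 * (cos (pi * (x - y) / N%:R) - cos (pi * (x + y) / N%:R)).
Proof.
rewrite /chord [pi * (x - y)]mulrBr [pi * (x + y)]mulrDr.
rewrite [(_ - _) / _]mulrBl [(_ + _) / _]mulrDl cosB cosD; ring.
Qed.

(** Moving a window by one step exchanges a pair of factors at one end for a
    pair at the other end; the two pairs have the same difference of
    arguments, so the cosines of the differences cancel. *)
Lemma chord_ends x y :
  chord x * chord (x + 1) - chord (x + y) * chord (x + y + 1)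
  = - (chord (x + x + y + 1) * chord y).
Proof.
rewrite !chordM (_ : x - (x + 1) = -1); last by ring.
rewrite (_ : x + y - (x + y + 1) = -1); last by ring.
rewrite (_ : x + x + y + 1 - y = x + (x + 1)); last by ring.
rewrite (_ : x + x + y + 1 + y = x + y + (x + y + 1)); last by ring.
by ring.
Qed.

Lemma Sprod0 : S 0 = 1.
Proof. by rewrite /Sprod big_geq. Qed.

Lemma SprodS k : S k.+1 = S k * chord k.+1%:R.
Proof. by rewrite /Sprod big_nat_recr. Qed.

Lemma Sprod_gt0 k : (k <= 4 * L)%N -> 0 < S k.
Proof.
elim: k => [|k IH] kL; first by rewrite Sprod0.
by rewrite SprodS mulr_gt0 ?IH ?chord_gt0 //; rewrite /dimN; lia.
Qed.

Lemma Sprod_neq0 k : (k <= 4 * L)%N -> S k != 0.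
Proof. by move=> kL; rewrite gt_eqF ?Sprod_gt0. Qed.

Lemma Sprod_eq0 k : (4 * L < k)%N -> S k = 0.
Proof.
elim: k => // k IH; rewrite ltnS leq_eqVlt => /orP[/eqP <-|/IH Sk0].
  rewrite SprodS (_ : (4 * L).+1%:R = N%:R - 0) ?subr0 //.
  by rewrite -[N%:R]subr0 chord_refl chord0 mulr0.
by rewrite SprodS Sk0 mul0r.
Qed.

(** The factors of [S (4 * L)] are symmetric about the middle, since
    [sin (pi * j / N) = sin (pi * (N - j) / N)]; the value is [N] by
    [Sprod_dim]. *)
Lemma Sprod_compl k : (k <= 4 * L)%N -> S k * S (4 * L - k) = S (4 * L).
Proof.
elim: k => [|k IH] kL; first by rewrite Sprod0 mul1r subn0.
rewrite -IH ?(ltnW kL) // SprodS -mulrA; congr (_ * _).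
rewrite (_ : 4 * L - k = (4 * L - k.+1).+1)%N; last by lia.
rewrite SprodS mulrC; congr (_ * _).
rewrite -[LHS]chord_refl; congr chord.
by rewrite -[in RHS]natr1 natrB // natrM dimNE; ring.
Qed.

(** * The q-binomial theorem *)

(** The q-binomial coefficient at [q = exp (2 i pi / N)], multiplied by the
    power of [q] that makes it real and symmetric under [s -> M - s]. *)
Definition sine_binom (M s : nat) : R := S M / (S s * S (M - s)).

Lemma sine_binomSl M s : (s <= M)%N -> (M < 4 * L)%N ->
  sine_binom M s =
  sine_binom M.+1 s * chord (M.+1 - s)%:R / chord M.+1%:R.
Proof.
move=> sM ML; rewrite /sine_binom subSn // !SprodS.
have h1 : chord M.+1%:R != 0 by apply: chord_neq0; rewrite /dimN; lia.
have h2 : chord (M - s).+1%:R != 0 by apply: chord_neq0; rewrite /dimN; lia.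
have h3 : S s != 0 by apply: Sprod_neq0; lia.
have h4 : S (M - s) != 0 by apply: Sprod_neq0; lia.
by field; rewrite h1 h2 h3 h4.
Qed.

Lemma sine_binomSr M s : (s <= M)%N -> (M < 4 * L)%N ->
  sine_binom M s =
  sine_binom M.+1 s.+1 * chord s.+1%:R / chord M.+1%:R.
Proof.
move=> sM ML; rewrite /sine_binom subSS !SprodS.
have h1 : chord M.+1%:R != 0 by apply: chord_neq0; rewrite /dimN; lia.
have h2 : chord s.+1%:R != 0 by apply: chord_neq0; rewrite /dimN; lia.
have h3 : S s != 0 by apply: Sprod_neq0; lia.
have h4 : S (M - s) != 0 by apply: Sprod_neq0; lia.
by field; rewrite h1 h2 h3 h4.
Qed.

(** The real form of Gauss's theorem
    [\prod_t (1 + q ^ t z) = \sum_s q ^ (s (s - 1) / 2) binom_q(M, s) z ^ s].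
    By induction on [M]: one factor [2 cos A] splits each [cos B] of degree [M]
    into [cos (A + B) + cos (A - B)], and the two contributions at a given
    frequency recombine, as in Pascal's rule, through
    [sin (a + b) cos phi = sin a cos (phi - b) + sin b cos (phi + a)].
    The bound on [M] keeps the denominators nonzero. *)
Lemma gauss_cos M x : (M <= 4 * L)%N ->
  \sum_(s < M.+1) sine_binom M s
     * cos ((2 * s%:R - M%:R) * (pi * x / N%:R)) =
  \prod_(t < M) (2 * cos (pi * (x + t%:R + (1 - M%:R) / 2) / N%:R)).
Proof.
elim: M x => [|M IH] x ML.
  rewrite big_ord1 big_ord0 /sine_binom Sprod0 mulr1 divr1 mul1r.
  by rewrite mulr0 subr0 mul0r cos0.
have cM : chord M.+1%:R != 0 by apply: chord_neq0; rewrite /dimN; lia.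
have nN := dimN_neq0.
rewrite big_ord_recl /=.
transitivity (2 * cos (pi * (x - M%:R / 2) / N%:R) *
  \sum_(s < M.+1) sine_binom M s
     * cos ((2 * s%:R - M%:R) * (pi * (x + 1 / 2) / N%:R))); last first.
  rewrite IH ?(ltnW ML) //; congr (_ * _).
    by congr (2 * cos (_ * _ / _)); rewrite -[M.+1%:R]natr1; field.
  apply: eq_bigr => t _; congr (2 * cos (pi * _ / _)).
  by rewrite /bump /= -[M.+1%:R]natr1 natrD; field.
(* [rise s] comes from the term [s - 1] of degree [M], [fall s] from the
   term [s]; [rise 0] and [fall M.+1] vanish. *)
pose phi s := (2 * s%:R - M.+1%:R) * (pi * x / N%:R).
pose rise s := sine_binom M.+1 s * chord s%:R / chord M.+1%:R
  * cos (phi s - pi * (M.+1%:R - s%:R) / N%:R).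
pose fall s := sine_binom M.+1 s * chord (M.+1 - s)%:R / chord M.+1%:R
  * cos (phi s + pi * s%:R / N%:R).
transitivity (\sum_(s < M.+2) (rise s + fall s)).
  apply: eq_bigr => -[s /= sM] _; rewrite /rise /fall -!/(phi s).
  transitivity (sine_binom M.+1 s / chord M.+1%:R * (cos (phi s) * chord M.+1%:R)).
    by field.
  rewrite (_ : cos _ * chord M.+1%:R =
      chord s%:R * cos (phi s - pi * (M.+1%:R - s%:R) / N%:R)
      + chord (M.+1 - s)%:R * cos (phi s + pi * s%:R / N%:R)); last first.
    rewrite natrB // -[M.+1%:R in LHS](subrK s%:R).
    move: (M.+1%:R - s%:R : R) => p; rewrite /chord mulrDr mulrDl.
    by rewrite cosB cosD sinD; ring.
  by field.
rewrite big_split /= big_ord_recl [X in _ + X]big_ord_recr /=.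
rewrite {1}/rise {2}/fall subnn chord0 !(mulr0, mul0r) add0r addr0.
rewrite -big_split [RHS]mulr_sumr; apply: eq_bigr => -[s /= sM] _.
rewrite /rise /fall -sine_binomSl // -sine_binomSr // -mulrDr mulrCA.
congr (_ * _); rewrite /phi /bump /=.
set A := pi * (x - _) / _; set B := (_ - _) * (pi * (x + _) / _).
rewrite (_ : 2 * _ * _ = cos (A + B) + cos (A - B)); last first.
  by rewrite cosB cosD; ring.
rewrite -[cos (A - B)]cosN.
congr (cos _ + cos _); rewrite /A /B -?[M.+1%:R]natr1; by field.
Qed.

(** At [M = 4 * L] all the coefficients of the binomial theorem are [1], so
    its value at [x = 0] counts the terms: this is the classical product
    [\prod_(j < N | 0 < j) 2 sin (pi * j / N) = N]. *)
Lemma Sprod_dim : S (4 * L) = N%:R.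
Proof.
transitivity (\prod_(t < 4 * L) chord t.+1%:R).
  by rewrite /Sprod big_add1 /= big_mkord.
transitivity (\sum_(s < N) sine_binom (4 * L) s
     * cos ((2 * s%:R - (4 * L)%:R) * (pi * 0 / N%:R))); last first.
  rewrite mulr0 mul0r (eq_bigr (fun=> 1)).
    by rewrite sumr_const card_ord.
  move=> -[s /= sL] _; rewrite mulr0 cos0 mulr1 /sine_binom Sprod_compl //.
  by rewrite divff // Sprod_neq0.
rewrite gauss_cos //; apply: eq_bigr => t _; rewrite /chord -cosBpihalf.
congr (2 * cos _); have := dimN_neq0; rewrite dimNE natrM -[t.+1%:R]natr1 => nN.
by field.
Qed.

(** * Windows: products of consecutive chords *)

Definition window (a : int) (p : nat) : R := \prod_(t < p) chord (a%:~R + t.+1%:R).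

Lemma windowSl a p : window a p.+1 = chord (a%:~R + 1) * window (a + 1) p.
Proof.
rewrite /window big_ord_recl; congr (_ * _); apply: eq_bigr => t _.
by congr chord; rewrite lift0 -![in LHS]natr1 -[in RHS]natr1; ring.
Qed.

Lemma windowSr a p : window a p.+1 = window a p * chord (a%:~R + p.+1%:R).
Proof. by rewrite /window big_ord_recr. Qed.

Lemma Sprod_window (a p : nat) : S (a + p) = S a * window a p.
Proof.
elim: p => [|p IH]; first by rewrite addn0 /window big_ord0 mulr1.
rewrite addnS SprodS IH windowSr -mulrA; congr (_ * (_ * chord _)).
by rewrite -addnS natrD.
Qed.

(** For [0 <= a] the window is a quotient [S (a + p) / S a], and
    [N / S a = S (4 * L - a)]. For [a < 0] both sides vanish: the window then
    contains [chord 0]. *)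
Lemma Sz_window (a : int) (p : nat) : a <= (4 * L)%:Z -> 0 <= a + p%:Z ->
  Sz (a + p%:Z) * Sz ((4 * L)%:Z - a) = N%:R * window a p.
Proof.
case: a => a aL ap.
  rewrite /Sz (_ : `|_|%N = (a + p)%N); last by lia.
  rewrite (_ : `|(4 * L)%:Z - a|%N = (4 * L - a)%N); last by lia.
  by rewrite Sprod_window mulrAC Sprod_compl ?Sprod_dim //; lia.
rewrite [X in _ * X]Sprod_eq0; last by lia.
have ltap : (a < p)%N by lia.
rewrite /window (bigD1 (Ordinal ltap)) //= (_ : _ + _ = 0) ?chord0 ?mul0r ?mulr0 //.
by rewrite NegzE; ring.
Qed.

(** The quarter turn [cos x = sin (x + pi / 2)] lands on integer multiples of
    [pi / N] because [N / 2 = 2 * L + 1 / 2] and the number of factors is even. *)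
Lemma gauss_window (m : nat) (j : int) : (m <= 2 * L)%N ->
  \sum_(s < (2 * m).+1) sine_binom (2 * m) s
     * cos (2 * pi * (s%:Z - m%:Z)%:~R * j%:~R / N%:R) =
  window ((2 * L)%:Z - m%:Z + j) (2 * m).
Proof.
move=> mL; have nN := dimN_neq0.
transitivity (\sum_(s < (2 * m).+1) sine_binom (2 * m) s
     * cos ((2 * s%:R - (2 * m)%:R) * (pi * j%:~R / N%:R))).
  by apply: eq_bigr => s _; congr (_ * cos _); rewrite natrM; field.
rewrite gauss_cos; last by lia.
apply: eq_bigr => t _; rewrite /chord -sinDpihalf; congr (2 * sin _).
rewrite dimNE -?[t.+1%:R]natr1 natrM in nN *; by field.
Qed.

(** * Cosine and sine sums of the vectors u and v *)

(** The entry u_(L-m)(k); with this index [m] the support is [`|k| <= m]. *)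
Definition profile (m : nat) (k : int) : R :=
  Sz ((4 * L)%:Z - m%:Z + k) * Sz ((4 * L)%:Z - m%:Z - k).

Lemma profileN m k : profile m (- k) = profile m k.
Proof. by rewrite /profile opprK mulrC. Qed.

Lemma profile_out m k : (m < `|k|)%N -> profile m k = 0.
Proof.
have [k0|k0] := leP 0 k => mk.
  by rewrite /profile [Sz _]Sprod_eq0 ?mul0r //; lia.
by rewrite /profile [X in _ * X]Sprod_eq0 ?mulr0 //; lia.
Qed.

Lemma profile_neq0 m k : (m <= 2 * L)%N -> (`|k| <= m)%N -> profile m k != 0.
Proof. by move=> mL km; rewrite mulf_neq0 ?Sprod_neq0 //; lia. Qed.

(** [S (4 * L - k) = N / S k] turns the product of two values of [S] into a
    sine-binomial coefficient. *)
Lemma profile_binom m s : (m <= 2 * L)%N -> (s <= 2 * m)%N ->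
  profile m (s%:Z - m%:Z) = N%:R ^+ 2 / S (2 * m) * sine_binom (2 * m) s.
Proof.
move=> mL sm; rewrite /profile /sine_binom.
rewrite (_ : Sz _ = S (4 * L - (2 * m - s))); last by congr S; lia.
rewrite (_ : Sz _ = S (4 * L - s)); last by congr S; lia.
have h1 : S s != 0 by apply: Sprod_neq0; lia.
have h2 : S (2 * m - s) != 0 by apply: Sprod_neq0; lia.
have h3 : S (2 * m) != 0 by apply: Sprod_neq0; lia.
rewrite expr2 -{1}Sprod_dim -(Sprod_compl (k := s)); last by lia.
rewrite -Sprod_dim -(Sprod_compl (k := 2 * m - s)); last by lia.
by field; rewrite h1 h2 h3.
Qed.

Lemma cidx_bound (i : 'I_N) : (`|cidx i| <= 2 * L)%N.
Proof. by case: i => i /= iN; rewrite /cidx /= /dimN in iN *; lia. Qed.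

Lemma cidx_rev (i : 'I_N) : cidx (rev_ord i) = - cidx i.
Proof. by case: i => i /= iN; rewrite /cidx /= /dimN in iN *; lia. Qed.

Lemma sum_centered (F : int -> R) m : (m <= 2 * L)%N ->
  (forall k, (m < `|k|)%N -> F k = 0) ->
  \sum_(i < N) F (cidx i) = \sum_(s < (2 * m).+1) F (s%:Z - m%:Z).
Proof.
move=> mL F0; rewrite -(big_mkord xpredT (fun i => F (i%:Z - (2 * L)%N%:Z))).
rewrite (@big_cat_nat _ _ _ (2 * L - m)) //=; last by rewrite /dimN; lia.
rewrite (@big_cat_nat _ _ _ (2 * L + m).+1 (2 * L - m)) //=; try by rewrite /dimN; lia.
rewrite big_nat_cond big1 ?add0r => [|i /andP[iL _]]; last by apply: F0; lia.
rewrite [X in _ + X]big_nat_cond [X in _ + X]big1 ?addr0 => [|i /andP[iL _]];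
  last by apply: F0; lia.
rewrite -{1}[(2 * L - m)%N]add0n big_addn big_mkord.
rewrite (_ : (2 * L + m).+1 - (2 * L - m) = (2 * m).+1)%N; last by lia.
by apply: eq_bigr => s _; congr F; lia.
Qed.

Lemma sum_odd (F : int -> R) : (forall k, F (- k) = - F k) ->
  \sum_(i < N) F (cidx i) = 0.
Proof.
move=> FN; suff: \sum_(i < N) F (cidx i) = - \sum_(i < N) F (cidx i) by lra.
rewrite -sumrN [RHS](reindex_inj rev_ord_inj) /=.
by apply: eq_bigr => i _; rewrite cidx_rev FN opprK.
Qed.

Lemma cos_sum_profile m (j : int) : (m <= 2 * L)%N ->
  \sum_(i < N) cos (2 * pi * (cidx i)%:~R * j%:~R / N%:R) * profile m (cidx i)
  = N%:R ^+ 2 / S (2 * m) * window ((2 * L)%:Z - m%:Z + j) (2 * m).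
Proof.
move=> mL.
rewrite (sum_centered (m := m)
  (F := fun k => cos (2 * pi * k%:~R * j%:~R / N%:R) * profile m k)) //; last first.
  by move=> k mk /=; rewrite profile_out ?mulr0.
rewrite -gauss_window // mulr_sumr; apply: eq_bigr => -[s /= sm] _.
by rewrite profile_binom // [LHS]mulrC -[LHS]mulrA !mulrA.
Qed.

(** The window of [cos_sum_profile] times [N] is a profile by [Sz_window], and
    [N / S (2 * m) = S (4 * L - 2 * m)]. *)
Lemma cos_profile m (j : int) : (m <= 2 * L)%N -> (`|j| <= 2 * L)%N ->
  \sum_(i < N) cos (2 * pi * (cidx i)%:~R * j%:~R / N%:R) * profile m (cidx i)
  = S (4 * L - 2 * m) * profile (2 * L - m) j.
Proof.
move=> mL jL; rewrite cos_sum_profile //.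
have h3 : S (2 * m) != 0 by apply: Sprod_neq0; lia.
rewrite (_ : profile _ j = N%:R * window ((2 * L)%:Z - m%:Z + j) (2 * m)).
  rewrite expr2 -{1}Sprod_dim -(Sprod_compl (k := 2 * m)); last by lia.
  by field.
rewrite -Sz_window; try lia.
by congr (Sz _ * Sz _); lia.
Qed.

(** Multiplying by [sin (2 * pi * k / N)] takes the difference of two shifts of
    the cosine sum. These windows share all but two factors at each end, and
    the remaining difference is again a product of sines. *)
Lemma sin_profile m (j : int) :
  (0 < m <= 2 * L)%N -> (`|j| <= 2 * L)%N ->
  \sum_(i < N) sin (2 * pi * (cidx i)%:~R * j%:~R / N%:R)
     * (sin (2 * pi * (cidx i)%:~R / N%:R) * profile m (cidx i))
  = S (4 * L + 1 - 2 * m)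
     * (sin (2 * pi * j%:~R / N%:R) * profile (2 * L + 1 - m) j).
Proof.
case: m => // m mL jL; have nN := dimN_neq0.
transitivity ((\sum_(i < N) cos (2 * pi * (cidx i)%:~R * (j - 1)%:~R / N%:R)
     * profile m.+1 (cidx i)
   - \sum_(i < N) cos (2 * pi * (cidx i)%:~R * (j + 1)%:~R / N%:R)
     * profile m.+1 (cidx i)) / 2).
  rewrite -sumrB mulr_suml; apply: eq_bigr => i _; set k : R := (cidx i)%:~R.
  rewrite (_ : _ * _ * (j - 1)%:~R / _ =
    2 * pi * k * j%:~R / N%:R - 2 * pi * k / N%:R); last by field.
  rewrite (_ : _ * _ * (j + 1)%:~R / _ =
    2 * pi * k * j%:~R / N%:R + 2 * pi * k / N%:R); last by field.
  by rewrite cosB cosD; field.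
rewrite !cos_sum_profile; try lia.
set b := (2 * L)%:Z - m.+1%:Z + j.
rewrite (_ : _ + (j - 1) = b - 1); last by rewrite /b; lia.
rewrite (_ : _ + (j + 1) = b + 1); last by rewrite /b; lia.
rewrite (_ : 2 * m.+1 = (2 * m).+2)%N; last by lia.
rewrite [window (b - 1) _]windowSl windowSl [window (b + 1) _]windowSr windowSr.
rewrite (_ : b - 1 + 1 + 1 = b + 1); last by ring.
rewrite (_ : profile _ j = N%:R * window (b + 1) (2 * m)); last first.
  rewrite -Sz_window /b; try lia.
  by congr (Sz _ * Sz _); lia.
have h2 : S (2 * m).+1 != 0 by apply: Sprod_neq0; lia.
have h3 : chord (2 * m).+2%:R != 0 by apply: chord_neq0; rewrite /dimN; lia.
rewrite SprodS (_ : 4 * L + 1 - (2 * m).+2 = 4 * L - (2 * m).+1)%N; last by lia.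
rewrite (_ : N%:R ^+ 2 / _ =
    S (4 * L - (2 * m).+1) * N%:R / chord (2 * m).+2%:R); last first.
  rewrite expr2 -{1}Sprod_dim -(Sprod_compl (k := (2 * m).+1)); last by lia.
  by field; rewrite h2 h3.
(* [W] is the common part of the two windows. *)
set W := window _ _; set c := chord (2 * m).+2%:R.
have key : chord ((b - 1)%:~R + 1) * chord ((b - 1 + 1)%:~R + 1)
   - chord ((b + 1)%:~R + (2 * m).+1%:R) * chord ((b + 1)%:~R + (2 * m).+2%:R)
   = 2 * sin (2 * pi * j%:~R / N%:R) * c.
  rewrite (_ : (b - 1)%:~R + 1 = b%:~R); last by ring.
  rewrite (_ : (b - 1 + 1)%:~R = b%:~R); last by ring.
  rewrite (_ : (b + 1)%:~R + (2 * m).+1%:R = b%:~R + (2 * m).+2%:R); last first.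
    by rewrite -[(2 * m).+2%:R]natr1; ring.
  rewrite (_ : (b + 1)%:~R + (2 * m).+2%:R = b%:~R + (2 * m).+2%:R + 1); last by ring.
  (* The sum of the arguments is [N + 2 j]: hence the factor
     [sin (2 pi j / N)], up to sign. *)
  rewrite chord_ends (_ : _ + _ + 1 = N%:R + 2 * j%:~R); last first.
    by rewrite dimNE /b -!natr1 natrM; ring.
  by rewrite chordDdim mulNr opprK /chord [pi * _]mulrCA mulrA.
transitivity (S (4 * L - (2 * m).+1) * N%:R * W / c / 2 *
   (chord ((b - 1)%:~R + 1) * chord ((b - 1 + 1)%:~R + 1)
   - chord ((b + 1)%:~R + (2 * m).+1%:R) * chord ((b + 1)%:~R + (2 * m).+2%:R))).
  by field.
by rewrite key; field.
Qed.

(** * The transform as a pair of real matrices *)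

Definition cosmx : 'M[R]_N := \matrix_(j, k)
  (invsqrtN R L * cos (2 * pi * (cidx k)%:~R * (cidx j)%:~R / N%:R)).

Definition sinmx : 'M[R]_N := \matrix_(j, k)
  (invsqrtN R L * sin (2 * pi * (cidx k)%:~R * (cidx j)%:~R / N%:R)).

Lemma sum_complex (I : finType) (x y : I -> R) :
  \sum_i (x i +i* y i)%C = ((\sum_i x i) +i* (\sum_i y i))%C.
Proof.
by apply: (big_rec3 (fun z u v => z = (u +i* v)%C)) => // i a b c _ ->.
Qed.

Lemma dft_toC (a : 'cV[R]_N) :
  dft (toC a) = \col_j ((cosmx *m a) j 0 -i* (sinmx *m a) j 0)%C.
Proof.
apply/colP => j; rewrite !mxE -sumrN -sum_complex mulr_sumr.
apply: eq_bigr => k _; rewrite !mxE /expi cosN sinN; simpc.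
by rewrite !mulrA.
Qed.

Lemma in_real_eigenspace (mu nu : R) (a : 'cV[R]_N) :
  (a \in real_eigenspace (mu -i* nu)%C)
  = (cosmx *m a == mu *: a) && (sinmx *m a == nu *: a).
Proof.
rewrite inE dft_toC; apply/eqP/andP => [/colP E|[/eqP -> /eqP ->]]; last first.
  by apply/colP => j; rewrite !mxE; simpc.
split; apply/eqP/colP => j; have := E j; rewrite [LHS]mxE [RHS]mxE [toC a j 0]mxE.
  by simpc; case=> -> _; rewrite mxE.
by simpc; case=> _ /oppr_inj ->; rewrite mxE.
Qed.

(** The indices are chosen so that [evec m] and [ovec m] live on [`|k| <= m]:
    the swaps n <-> -n and n <-> -n-1 become m <-> 2L-m and m <-> 2L+1-m. *)
Definition evec m := uvec R L (L%:Z - m%:Z).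
Definition ovec m := vvec R L (L%:Z - m%:Z).
Definition ecoef m : R := invsqrtN R L * S (4 * L - 2 * m).
Definition ocoef m : R := invsqrtN R L * S (4 * L + 1 - 2 * m).

Lemma evecE m i : evec m i 0 = profile m (cidx i).
Proof. by rewrite mxE; congr (Sz _ * Sz _); lia. Qed.

Lemma ovecE m i : ovec m i 0 = sin (2 * pi * (cidx i)%:~R / N%:R) * profile m (cidx i).
Proof. by rewrite mxE -mulrA; congr (_ * (Sz _ * Sz _)); lia. Qed.

Lemma cosmx_evec m : (m <= 2 * L)%N -> cosmx *m evec m = ecoef m *: evec (2 * L - m).
Proof.
move=> mL; apply/colP => j; rewrite [LHS]mxE [RHS]mxE.
under eq_bigr => k _ do rewrite evecE mxE -mulrA.
by rewrite -mulr_sumr cos_profile ?cidx_bound // evecE mulrA.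
Qed.

Lemma sinmx_evec m : sinmx *m evec m = 0.
Proof.
apply/colP => j; rewrite !mxE.
under eq_bigr => k _ do rewrite evecE mxE.
apply: (sum_odd (F := fun k => _ * sin (_ * k%:~R * _ / _) * profile m k)) => k.
by rewrite profileN rmorphN mulrN !mulNr sinN mulrN mulNr.
Qed.

Lemma sinmx_ovec m : (0 < m <= 2 * L)%N ->
  sinmx *m ovec m = ocoef m *: ovec (2 * L + 1 - m).
Proof.
move=> mL; apply/colP => j; rewrite [LHS]mxE [RHS]mxE.
under eq_bigr => k _ do rewrite ovecE mxE -mulrA.
by rewrite -mulr_sumr sin_profile ?cidx_bound // ovecE mulrA.
Qed.

Lemma cosmx_ovec m : cosmx *m ovec m = 0.
Proof.
apply/colP => j; rewrite !mxE.
under eq_bigr => k _ do rewrite ovecE mxE.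
apply: (sum_odd (F := fun k => _ * cos (_ * k%:~R * _ / _)
          * (sin (_ * k%:~R / _) * profile m k))) => k.
by rewrite profileN rmorphN !mulrN !mulNr sinN cosN mulNr mulrN.
Qed.

Lemma invsqrtN_sqr : invsqrtN R L ^+ 2 * N%:R = 1.
Proof. by rewrite exprVn sqr_sqrtr ?ler0n // mulVf // dimN_neq0. Qed.

Lemma ecoefK m : (m <= 2 * L)%N -> ecoef m * ecoef (2 * L - m) = 1.
Proof.
move=> mL; rewrite -invsqrtN_sqr -Sprod_dim -(Sprod_compl (k := 4 * L - 2 * m)); last by lia.
rewrite /ecoef (_ : 4 * L - (4 * L - 2 * m) = 4 * L - 2 * (2 * L - m))%N; last by lia.
by ring.
Qed.

Lemma ocoefK m : (0 < m <= 2 * L)%N -> ocoef m * ocoef (2 * L + 1 - m) = 1.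
Proof.
move=> mL; rewrite -invsqrtN_sqr -Sprod_dim -(Sprod_compl (k := 4 * L + 1 - 2 * m)); last by lia.
rewrite /ocoef (_ : 4 * L - (4 * L + 1 - 2 * m) = 4 * L + 1 - 2 * (2 * L + 1 - m))%N; last by lia.
by ring.
Qed.

(** * Generation by the even and odd vectors *)

Definition coord_at (k : nat) : 'I_N := inord (2 * L + k).

Lemma cidx_at k : (k <= 2 * L)%N -> cidx (coord_at k) = k%:Z.
Proof. by move=> kL; rewrite /cidx inordK; lia. Qed.

Lemma cidx_at_opp k : (k <= 2 * L)%N -> cidx (rev_ord (coord_at k)) = - k%:Z.
Proof. by move=> kL; rewrite cidx_rev cidx_at. Qed.

Lemma sin_cidx_neq0 k : (0 < k <= 2 * L)%N -> sin (2 * pi * k%:R / N%:R) != 0 :> R.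
Proof.
move=> kL; have := @chord_neq0 (2 * k).
rewrite /chord mulf_eq0 negb_or natrM mulrA [pi * 2]mulrC => /(_ _)/andP[] //.
by rewrite /dimN; lia.
Qed.

Lemma evec_top_neq0 m : (m <= 2 * L)%N -> evec m (coord_at m) 0 != 0.
Proof. by move=> mL; rewrite evecE cidx_at // profile_neq0 //; lia. Qed.

Lemma evec_out m k : (m < k <= 2 * L)%N -> evec m (coord_at k) 0 = 0.
Proof. by move=> mk; rewrite evecE profile_out // cidx_at; lia. Qed.

Lemma ovec_top_neq0 m : (0 < m <= 2 * L)%N -> ovec m (coord_at m) 0 != 0.
Proof.
move=> mL; rewrite ovecE cidx_at; last by lia.
by rewrite mulf_neq0 ?sin_cidx_neq0 ?profile_neq0 //; lia.
Qed.

Lemma ovec_out m k : (m < k <= 2 * L)%N -> ovec m (coord_at k) 0 = 0.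
Proof. by move=> mk; rewrite ovecE profile_out ?mulr0 // cidx_at; lia. Qed.

Lemma cidx_inj : injective (@cidx L).
Proof. by move=> i j ij; apply/val_inj; move: ij; rewrite /cidx /=; lia. Qed.

Lemma evec_rev m i : evec m (rev_ord i) 0 = evec m i 0.
Proof. by rewrite !evecE cidx_rev profileN. Qed.

Lemma ovec_rev m i : ovec m (rev_ord i) 0 = - ovec m i 0.
Proof. by rewrite !ovecE cidx_rev profileN rmorphN mulrN !mulNr sinN mulNr. Qed.

(** One notation for both parities, [b] being true on odd vectors: it shifts
    the lower bound of the index [m] and the reflection [m -> 2L + b - m] by
    one. *)
Definition pvec (b : bool) m := if b then ovec m else evec m.
Definition pmx (b : bool) := if b then sinmx else cosmx.
Definition pcoef (b : bool) m := if b then ocoef m else ecoef m.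

(** By induction on the support [`|k| <= K]: the even and the odd parts of the
    two extreme entries are removed with multiples of [evec K] and [ovec K],
    whose extreme entries are nonzero. *)
Lemma parity_ind (P : 'cV[R]_N -> Prop) :
  P 0 -> (forall c a b, P a -> P b -> P (c *: a + b)) ->
  (forall (b : bool) m, (b <= m <= 2 * L)%N -> P (pvec b m)) ->
  forall a, P a.
Proof.
move=> P0 PD PE; have PU := PE false; have PV := PE true.
suff H k : (k <= 2 * L)%N ->
    forall a : 'cV[R]_N, (forall i, (k < `|cidx i|)%N -> a i 0 = 0) -> P a.
  by move=> a; apply: (H (2 * L)%N) => // i; have := cidx_bound i; lia.
elim: k => [|k IH] kL a a0.
  have p0 := evec_top_neq0 kL; set i0 := coord_at 0 in p0.
  rewrite (_ : a = (a i0 0 / evec 0 i0 0) *: evec 0 + 0); first by apply: PD => //; apply: PU.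
  apply/colP => i; rewrite addr0 [RHS]mxE.
  have [->|ii0] := eqVneq i i0; first by rewrite divfK.
  have ci : (0 < `|cidx i|)%N.
    rewrite lt0n; apply: contra ii0 => /eqP ci; apply/eqP/cidx_inj.
    by rewrite /i0 cidx_at //; lia.
  by rewrite a0 // [evec 0 i 0]evecE profile_out ?mulr0.
have p0 := evec_top_neq0 kL; have q0 := @ovec_top_neq0 k.+1 kL.
set i0 := coord_at k.+1 in p0 q0.
set al := (a i0 0 + a (rev_ord i0) 0) / (2 * evec k.+1 i0 0).
set be := (a i0 0 - a (rev_ord i0) 0) / (2 * ovec k.+1 i0 0).
rewrite -[a](addrNK (al *: evec k.+1 + be *: ovec k.+1)) addrC -addrA.
apply: (PD) (PU _ kL) _; apply: (PD) (PV k.+1 kL) _; apply: IH; first by lia.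
move=> i ki; rewrite (_ : _ i 0 = a i 0 - (al * evec k.+1 i 0 + be * ovec k.+1 i 0)).
  2: by rewrite !mxE.
have [ki'|ki'] := ltnP k.+1 `|cidx i|.
  by rewrite a0 // evecE ovecE profile_out // !mulr0 addr0 subr0.
have [->|->] : i = i0 \/ i = rev_ord i0.
- have [c0|c0] := leP 0 (cidx i); [left|right]; apply/cidx_inj.
    by rewrite cidx_at //; lia.
  by rewrite cidx_at_opp //; lia.
- by rewrite /al /be; field; rewrite p0 q0.
by rewrite evec_rev ovec_rev /al /be; field; rewrite p0 q0.
Qed.

(** * Eigenvectors and bases of the eigenspaces *)

Lemma pmx_pvec (b : bool) m : (b <= m <= 2 * L)%N ->
  pmx b *m pvec b m = pcoef b m *: pvec b (2 * L + b - m).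
Proof. by case: b => mL; rewrite /= ?sinmx_ovec ?cosmx_evec ?addn0. Qed.

Lemma pmx_pvec_neg (b : bool) m : pmx (~~ b) *m pvec b m = 0.
Proof. by case: b; [exact: cosmx_ovec | exact: sinmx_evec]. Qed.

Lemma pcoefK (b : bool) m : (b <= m <= 2 * L)%N ->
  pcoef b m * pcoef b (2 * L + b - m) = 1.
Proof. by case: b => mL /=; rewrite ?ocoefK ?addn0 ?ecoefK. Qed.

Lemma pcoef_gt0 (b : bool) m : (b <= m <= 2 * L)%N -> 0 < pcoef b m.
Proof.
by case: b => mL; rewrite mulr_gt0 ?invr_gt0 ?sqrtr_gt0 ?ltr0n ?Sprod_gt0 //; lia.
Qed.

(** The index [L] is its own reflection, so the coefficient is its own inverse;
    it is positive. *)
Lemma pcoef_mid : pcoef false L = 1.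
Proof.
have LL : (false <= L <= 2 * L)%N by lia.
have := pcoefK LL; have := pcoef_gt0 LL.
rewrite (_ : 2 * L + false - L = L)%N; last by lia.
move: (pcoef _ _) => c c0 /eqP; rewrite -expr2 sqrf_eq1 => /orP[/eqP //|/eqP cN1].
by move: c0; rewrite cN1; lra.
Qed.

Lemma pvec_top_neq0 (b : bool) m :
  (b <= m <= 2 * L)%N -> pvec b m (coord_at m) 0 != 0.
Proof. by case: b => mL; rewrite /= ?evec_top_neq0 ?ovec_top_neq0. Qed.

Lemma pvec_out (b : bool) m k :
  (m < k <= 2 * L)%N -> pvec b m (coord_at k) 0 = 0.
Proof. by case: b => mk; rewrite /= ?evec_out ?ovec_out. Qed.

(** For [m <= L], the vectors w and x ([e = 1]) or y and z ([e = -1]). *)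
Definition eigvec (b : bool) (e : R) m :=
  e *: pvec b m + pcoef b m *: pvec b (2 * L + b - m).

Lemma eigvecE (b : bool) e m : (b <= m <= 2 * L)%N -> e * e = 1 ->
  [/\ pmx b *m eigvec b e m = e *: eigvec b e m,
      pmx b *m (pmx b *m pvec b m) + e *: (pmx b *m pvec b m) = e *: eigvec b e m
    & pmx b *m (pmx b *m pvec b (2 * L + b - m))
      + e *: (pmx b *m pvec b (2 * L + b - m))
      = pcoef b (2 * L + b - m) *: eigvec b e m].
Proof.
move=> mL ee; apply: eigen_pair => //; [exact: pmx_pvec| |exact: pcoefK].
rewrite pmx_pvec; last by lia.
by congr (_ *: pvec b _); lia.
Qed.

Lemma eigvec_at (b : bool) e m i : eigvec b e m i 0
  = e * pvec b m i 0 + pcoef b m * pvec b (2 * L + b - m) i 0.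
Proof. by rewrite [LHS]mxE [X in X + _]mxE [X in _ + X]mxE. Qed.

Lemma eigvec_other (b : bool) e m : pmx (~~ b) *m eigvec b e m = 0.
Proof. by rewrite mulmxDr -!scalemxAr !pmx_pvec_neg !scaler0 addr0. Qed.

Lemma eigvec_mid : eigvec false (-1) L = 0.
Proof.
rewrite /eigvec pcoef_mid scaleN1r scale1r (_ : 2 * L + false - L = L)%N; last by lia.
exact: addNr.
Qed.

(** At the end of the support of the longer vector the shorter one vanishes,
    except for the self-reflected index [L], where the two vectors coincide and
    cancel if [e = -1]. *)
Lemma eigvec_top_neq0 (b : bool) e m : (b <= m <= L)%N ->
  b || (m < L)%N || (e == 1) -> eigvec b e m (coord_at (2 * L + b - m)) 0 != 0.
Proof.
move=> mL be; rewrite eigvec_at.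
have [lt|le] := ltnP m (2 * L + b - m).
  rewrite pvec_out ?mulr0 ?add0r ?mulf_neq0 ?pvec_top_neq0 ?gt_eqF ?pcoef_gt0 //; lia.
have [b0 mE] : b = false /\ m = L by case: b be mL le => /=; lia.
move: be; rewrite b0 mE ltnn !orFb => /eqP ->.
rewrite (_ : 2 * L + false - L = L)%N; last by lia.
rewrite pcoef_mid !mul1r -mulr2n mulrn_eq0 /=.
by rewrite (@pvec_top_neq0 false) //=; lia.
Qed.

Lemma eigvec_out (b : bool) e m k : (b <= m <= L)%N ->
  (2 * L + b - m < k <= 2 * L)%N -> eigvec b e m (coord_at k) 0 = 0.
Proof.
move=> mL mk; rewrite eigvec_at.
by rewrite !pvec_out ?mulr0 ?addr0 //; lia.
Qed.

(** An eigenvector is fixed by the projector [(T ^ 2 + e T) / 2], which maps the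
    generators of [parity_ind] of the right parity into [X] and kills the
    others. *)
Lemma eigen_in_span (b : bool) (e : R) (X : {vspace 'cV[R]_N}) : e * e = 1 ->
  (forall m, (b <= m <= L)%N -> eigvec b e m \in X) ->
  forall a, pmx b *m a = e *: a -> a \in X.
Proof.
move=> ee Xg a Ta; set T := pmx b in Ta.
suff: T *m (T *m a) + e *: (T *m a) \in X.
  rewrite Ta -scalemxAr Ta !scalerA ee scale1r -mulr2n -scaler_nat => /(memvZ 2^-1).
  by rewrite scalerA mulVf ?scale1r // pnatr_eq0.
move: a {Ta}; apply: parity_ind => //.
- by rewrite !mulmx0 scaler0 addr0 mem0v.
- move=> c a1 a2 Xa Xb; rewrite !mulmxDr -!scalemxAr.
  rewrite scalerDr [e *: (c *: _)]scalerA [e * c]mulrC -scalerA addrACA -scalerDr.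
  by rewrite memvD // memvZ.
move=> b' m; have [<- mL|bb' _] := eqVneq b b'; last first.
  rewrite /T (_ : b = ~~ b'); last by case: b b' bb' {Xg T} => -[].
  by rewrite pmx_pvec_neg mulmx0 scaler0 addr0 mem0v.
have [mL'|Lm] := leqP m L.
  by have [_ -> _] := @eigvecE b e m mL ee; rewrite memvZ // Xg //; lia.
have mR : (b <= 2 * L + b - m <= 2 * L)%N by lia.
have [_ _] := eigvecE mR ee.
rewrite (_ : 2 * L + b - (2 * L + b - m) = m)%N; last by lia.
by move=> ->; rewrite memvZ // Xg //; lia.
Qed.

(** The shift [s] skips the vector [eigvec false (-1) L = 0]; it is [1] only for
    the even vectors of sign [-1]. *)
Lemma is_basis_eigvec (b : bool) (e : R) (s p : nat) (X : 'I_p -> 'cV[R]_N) :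
  e = 1 /\ s = 0%N \/ e = -1 /\ s = ~~ b :> nat ->
  (p + s + b = L.+1)%N ->
  (forall n : 'I_p, X n = eigvec b e (L - (n + s))) ->
  is_basis (real_eigenspace (if b then 0 -i* e else e -i* 0)%C) [tuple X i | i < p].
Proof.
move=> es psb XE.
have ee : e * e = 1 by case: es => -[-> _]; rewrite ?mulrNN mulr1.
have nb (n : 'I_p) : (b <= L - (n + s) <= L)%N by have := ltn_ord n; lia.
have E_pmx a : (a \in real_eigenspace (if b then 0 -i* e else e -i* 0)%C)
    = (pmx b *m a == e *: a) && (pmx (~~ b) *m a == 0).
  by case: (b); rewrite in_real_eigenspace scale0r // andbC.
split=> [|a].
  apply: (free_triangular (pos := fun n : 'I_p =>
      coord_at (2 * L + b - (L - (n + s))))) => [n|n k nk]; rewrite XE.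
    apply: eigvec_top_neq0; first exact: nb.
    have nlt := ltn_ord n; case: es => -[e1 sE]; first by rewrite e1 eqxx !orbT.
    by apply/orP; left; case: (b) sE psb => //= sE psb'; lia.
  by apply: eigvec_out; first exact: nb; have := ltn_ord k; lia.
rewrite E_pmx; apply/idP/andP => [/coord_span ->|[/eqP Ta _]].
  split; apply/eqP; rewrite mulmx_sumr.
    rewrite scaler_sumr; apply: eq_bigr => i _; rewrite nth_mktuple -scalemxAr XE.
    have iL : (b <= L - (i + s) <= 2 * L)%N by have := nb i; lia.
    have [-> _ _] := eigvecE iL ee.
    by rewrite !scalerA mulrC.
  rewrite big1 // => i _.
  by rewrite nth_mktuple -scalemxAr XE eigvec_other scaler0.
apply: (eigen_in_span ee _ Ta) => m mL.
(* [m = L - (n + s)] for some [n], unless [eigvec b e m] is the zero vector. *)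
have [sm|ms] := leqP s (L - m).
  have ip : (L - m - s < p)%N by lia.
  rewrite (_ : eigvec b e m = X (Ordinal ip)).
    by apply/memv_span/map_f; rewrite mem_enum.
  by rewrite XE; congr eigvec => /=; lia.
have [e1 b0 mE] : [/\ e = -1, b = false & m = L].
  case: es => -[e1 sE]; first by move: ms; rewrite sE.
  have b0 : b = false by apply: contraTF ms => bT; rewrite sE bT.
  by split=> //; rewrite b0 in sE mL; lia.
by rewrite e1 b0 mE eigvec_mid mem0v.
Qed.

Lemma wvecE n : (n <= L)%N -> wvec R L n = eigvec false 1 (L - n).
Proof.
move=> nL; rewrite /eigvec scale1r.
by congr (uvec _ _ _ + (_ * S _) *: uvec _ _ _); lia.
Qed.

Lemma xvecE n : (n < L)%N -> xvec R L n = eigvec true 1 (L - n).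
Proof.
move=> nL; rewrite /eigvec scale1r.
by congr (vvec _ _ _ + (_ * S _) *: vvec _ _ _); lia.
Qed.

Lemma yvecE n : (n < L)%N -> yvec R L n = eigvec false (-1) (L - n.+1).
Proof.
move=> nL; rewrite /eigvec scaleN1r.
by congr (- uvec _ _ _ + (_ * S _) *: uvec _ _ _); lia.
Qed.

Lemma zvecE n : (n < L)%N -> zvec R L n = eigvec true (-1) (L - n).
Proof.
move=> nL; rewrite /eigvec scaleN1r.
by congr (- vvec _ _ _ + (_ * S _) *: vvec _ _ _); lia.
Qed.
End CenteredDFT.

Theorem corollary1 (R : realType) (L : nat) :
  [/\ is_basis (@real_eigenspace R L 1) [tuple wvec R L n | n < L.+1],
      is_basis (@real_eigenspace R L (- 'i%C)) [tuple xvec R L n | n < L],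
      is_basis (@real_eigenspace R L (-1)) [tuple yvec R L n | n < L]
    & is_basis (@real_eigenspace R L 'i%C) [tuple zvec R L n | n < L]].
Proof.
have -> : -1 = ((-1) -i* 0)%C :> complex R by simpc.
have -> : 1 = (1 -i* 0)%C :> complex R by rewrite oppr0.
have -> : - 'i%C = (0 -i* 1)%C :> complex R by simpc.
have -> : 'i%C = (0 -i* (-1))%C :> complex R by rewrite opprK.
split.
- apply: (is_basis_eigvec (b := false) (s := 0)); [by left|by lia|].
  by move=> n; rewrite addn0 wvecE // -ltnS.
- apply: (is_basis_eigvec (b := true) (s := 0)); [by left|by lia|].
  by move=> n; rewrite addn0 xvecE.
- apply: (is_basis_eigvec (b := false) (s := 1)); [by right|by lia|].
  by move=> n; rewrite addn1 yvecE.
apply: (is_basis_eigvec (b := true) (s := 0)); [by right|by lia|].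
by move=> n; rewrite addn0 zvecE.
Qed.
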